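(* Let $n,k,\ell$ be positive integers and let $\mathcal{F}\subseteq[n]^{(k)}$ and $\mathcal{G}\subseteq[n]^{(\ell)}$ be cross-intersecting. Then there are sets $M_1\subseteq M_2\subseteq\dots\subseteq M_k\subseteq[n]$ with $\vert M_i\vert\geq n-(k+1-i)\ell$ for each $i\in[k]$ such that one of the following holds: (1) the family $\mathcal{F}(A)$ is pseudo-intersecting for all $i\in[k]$ and all $A\in M_i^{(i)}$; or (2) the family $\mathcal{G}(B)$ is pseudo-intersecting for all $B\subseteq M_2$.
   Context: $[n]=\{1,\dots,n\}$ and $X^{(k)}$ denotes the set of $k$-element subsets of $X$. Families $\mathcal{F},\mathcal{G}$ are cross-intersecting if $F\cap G\neq\emptyset$ for every $F\in\mathcal{F}$, $G\in\mathcal{G}$. The shadow of a family $\mathcal{H}$ of sets is $\partial\mathcal{H}=\{H\setminus\{x\}: x\in H\in\mathcal{H}\}$. For $A,B\subseteq[n]$, $\mathcal{F}(A,\overline{B})=\{F\setminus A: F\in\mathcal{F},\ A\subseteq F,\ B\cap F=\emptyset\}$ and $\mathcal{F}(A)=\mathcal{F}(A,\overline{\emptyset})$ (similarly for $\mathcal{G}$). A family $\mathcal{H}$ of subsets of $[n]$ is pseudo-intersecting if $\vert\partial(\mathcal{H}(\overline{X}))\vert\geq\vert\mathcal{H}(\overline{X})\vert$ for all $X\subseteq[n]$, where $\mathcal{H}(\overline{X})=\{H\in\mathcal{H}: H\cap X=\emptyset\}$. *)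

(* Defs.v *)
From mathcomp Require Export all_boot.

Set Implicit Arguments.
Unset Strict Implicit.
Unset Printing Implicit Defensive.

Section Families.
Variable T : finType.
Implicit Types (A B X : {set T}) (F G H : {set {set T}}).

Definition uniform (r : nat) F : Prop := forall A, A \in F -> #|A| = r.

Definition cross_intersecting F G : Prop :=
  forall A B, A \in F -> B \in G -> A :&: B != set0.

Definition shadow H : {set {set T}} := [set S :\ x | S in H, x in S].

(* H(A, \overline{B}) *)
Definition restriction H A B : {set {set T}} :=
  [set S :\: A | S in H & (A \subset S) && (B :&: S == set0)].

(* H(A) *)
Definition link H A : {set {set T}} := restriction H A set0.

(* H(\overline{X}) *)
Definition avoiding H X : {set {set T}} := [set S in H | S :&: X == set0].

Definition pseudo_intersecting H : Prop :=
  forall X, #|avoiding H X| <= #|shadow (avoiding H X)|.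

End Families.

(* Main.v *)
From mathcomp Require Import all_fingroup.
From mathcomp Require Import zify.
Require Import Defs.

(** Call a family H deficient if |∂H| < |H|.  Splitting along an element x gives
    |∂H| >= |∂H(\bar x)| + |∂H(x)|, so a deficient H has H(\bar x) or H(x)
    deficient.

    Two cross-intersecting uniform families on a ground set V cannot both be
    deficient.  This goes by induction on |V|, after shifting both families away
    from some x in V: the only case the splitting does not settle is the one where
    F(x) and G(x) are deficient.  If S in F(x) and T in G(x) were disjoint, then
    |V| >= 2k and |V| >= 2l (double counting for deficient families) leave room
    for some z outside S, T and x, and the shifted family F contains z |: S, which
    misses x |: T.

    For the theorem, start with M_(k+1) = [n].  Given M_(i+1), either all G(B)
    with B inside M_(i+1) are pseudo-intersecting, or we pick a maximal B for
    which G(B) is not and put M_i = M_(i+1) \ B.  If F(A) were not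
    pseudo-intersecting for an i-set A inside M_i, then by the splitting
    inequality, the maximality of B and the property of M_(i+1), the deficient
    subfamilies of F(A) and G(B) could be taken to avoid M_(i+1); as A and B are
    disjoint they would be cross-intersecting, a contradiction. *)

Set Implicit Arguments.
Unset Strict Implicit.
Unset Printing Implicit Defensive.

(** * Deficient families: splitting along an element, and a bound on the ground set *)

Section Deficient.
Variable T : finType.
Implicit Types (x y z : T) (A B M P S V X Y : {set T}) (F G H : {set {set T}}).

Definition deficient H := #|shadow H| < #|H|.

Lemma in_shadow H P :
  reflect (exists2 y, y \notin P & y |: P \in H) (P \in shadow H).
Proof.
apply: (iffP imset2P) => [[S y SH yS ->]|[y yP yPH]].
  by exists y; rewrite ?setD11 // setD1K.
by exists (y |: P) y; rewrite ?setU11 // setU1K.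
Qed.

Lemma in_link H A S :
  (S \in link H A) = (S :&: A == set0) && (A :|: S \in H).
Proof.
apply/imsetP/andP => [[U]|[dSA SAH]].
  rewrite inE => /and3P[UH AU _] ->; split.
    by apply/eqP/setP=> y; rewrite !inE; case: (y \in A); rewrite ?andbF.
  suff ->: A :|: U :\: A = U by [].
  apply/setP=> y; rewrite !inE.
  by case yA: (y \in A) => //=; rewrite (subsetP AU).
exists (A :|: S).
  by rewrite inE SAH subsetUl set0I eqxx.
apply/setP=> y; rewrite !inE; move/eqP/setP: dSA => /(_ y).
by rewrite !inE; case: (y \in A); rewrite ?andbT // andbF => ->.
Qed.

Lemma in_link1 H x S : (S \in link H [set x]) = (x \notin S) && (x |: S \in H).
Proof. by rewrite in_link setI_eq0 disjoint_sym disjoints1. Qed.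

Lemma in_avoiding H X S : (S \in avoiding H X) = (S \in H) && (S :&: X == set0).
Proof. by rewrite inE. Qed.

Lemma in_avoiding1 H x S :
  (S \in avoiding H [set x]) = (S \in H) && (x \notin S).
Proof. by rewrite inE setI_eq0 disjoint_sym disjoints1. Qed.

Lemma link_link1 H A x : x \notin A -> link (link H A) [set x] = link H (x |: A).
Proof.
move=> xA; apply/setP=> S; rewrite in_link1 !in_link setUCA setUA andbA.
congr (_ && _); apply/andP/eqP => [[xS /eqP/setP dS]|/setP dS].
  apply/setP=> y; have := dS y; rewrite !inE.
  by case: (y =P x) => [->|_]; rewrite //= (negPf xS).
split; first by have := dS x; rewrite !inE eqxx andbT => ->.
apply/eqP/setP=> y; have := dS y; rewrite !inE.
by case: (y =P x) => [->|_]; rewrite //= (negPf xA).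
Qed.

Lemma avoiding_avoiding1 H X x :
  avoiding (avoiding H X) [set x] = avoiding H (x |: X).
Proof.
apply/setP=> S; rewrite in_avoiding1 !in_avoiding -andbA; congr (_ && _).
by rewrite setIUr setU_eq0 [in RHS]setI_eq0 disjoint_sym disjoints1 andbC.
Qed.

Lemma link1_avoiding H X x :
  x \notin X -> link (avoiding H X) [set x] = avoiding (link H [set x]) X.
Proof.
move=> xX; apply/setP=> S; rewrite in_link1 !in_avoiding in_link1 -!andbA.
by rewrite setIUl setU_eq0 (setI_eq0 [set x]) disjoints1 xX.
Qed.

Lemma setU1_inj_notin x S S' :
  x \notin S -> x \notin S' -> x |: S = x |: S' -> S = S'.
Proof. by move=> xS xS' e; rewrite -(setU1K xS) e setU1K. Qed.

Lemma leq_card_split H x :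
  #|H| <= #|avoiding H [set x]| + #|link H [set x]|.
Proof.
have sub : H \subset avoiding H [set x] :|: setU [set x] @: link H [set x].
  apply/subsetP=> S SH; rewrite inE in_avoiding1 SH /=.
  case: (boolP (x \in S)) => //= xS; apply/imsetP; exists (S :\ x).
    by rewrite in_link1 setD11 setD1K.
  by rewrite setD1K.
apply: leq_trans (subset_leq_card sub) _.
by apply: leq_trans (leq_card_setU _ _) _; rewrite leq_add2l leq_imset_card.
Qed.

(** Adding x to the members of the shadow of the link is injective and lands in [shadow H]. The
    resulting sets contain x, whereas the shadow of the avoiding part has no member containing x. *)
Lemma leq_shadow_split H x :
  #|shadow (avoiding H [set x])| + #|shadow (link H [set x])| <= #|shadow H|.
Proof.
have notinL S : S \in shadow (link H [set x]) -> x \notin S.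
  case/in_shadow=> y _; rewrite in_link1 !inE negb_or.
  by case/andP=> /andP[].
have notinA S : S \in shadow (avoiding H [set x]) -> x \notin S.
  case/in_shadow=> y _; rewrite in_avoiding1 !inE negb_or.
  by case/and3P.
rewrite -[X in _ + X](card_in_imset (f := setU [set x])); last first.
  by move=> S S' /notinL xS /notinL xS'; apply: setU1_inj_notin.
rewrite -cardsUI.
have -> : shadow (avoiding H [set x]) :&:
    setU [set x] @: shadow (link H [set x]) = set0.
  apply/setP=> S; rewrite in_set0; apply/negP=> /setIP[/notinA xS /imsetP[S' _ e]].
  by rewrite e setU11 in xS.
rewrite cards0 addn0; apply: subset_leq_card; apply/subsetP=> S.
case/setUP=> [/in_shadow[y yS]|/imsetP[S' S'L ->]].
  by rewrite in_avoiding1 => /andP[ySH _]; apply/in_shadow; exists y.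
case/in_shadow: (S'L) => y yS'; rewrite in_link1 !inE negb_or.
case/andP=> /andP[nyx _] ySH; apply/in_shadow; exists y; last by rewrite setUCA.
by rewrite !inE negb_or yS' eq_sym nyx.
Qed.

Lemma deficient_split H x :
  deficient H -> deficient (avoiding H [set x]) \/ deficient (link H [set x]).
Proof.
rewrite /deficient; have := leq_card_split H x; have := leq_shadow_split H x.
move=> *; lia.
Qed.

Lemma deficient_nonempty H : deficient H -> exists S, S \in H.
Proof. by move=> dH; apply/card_gt0P; apply: leq_ltn_trans dH. Qed.

Lemma card_dep_pairs (E : {set T} -> {set T}) H :
  #|[set p : {set T} * T | (p.1 \in H) && (p.2 \in E p.1)]| =
  \sum_(S in H) #|E S|.
Proof.
rewrite -sum1dep_card -(pair_big_dep _ (fun S y => y \in E S) (fun _ _ => 1)).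
by apply: eq_bigr => S _; rewrite sum1_card.
Qed.

(** For k > 0, sending a pair (S, y) with y in S to (S \ y, y) gives k|H| <= (|V| - k + 1)|∂H|, so
    deficiency forces k < |V| - k + 1. *)
Lemma deficient_card V H k :
  (forall S, S \in H -> S \subset V) -> uniform k H -> deficient H ->
  k.*2 <= #|V|.
Proof.
move=> HV uH dH; have [S0 S0H] := deficient_nonempty dH.
have kV : k <= #|V| by rewrite -(uH _ S0H); apply: subset_leq_card (HV _ S0H).
pose f (p : {set T} * T) := (p.1 :\ p.2, p.2).
pose A := [set p : {set T} * T | (p.1 \in H) && (p.2 \in p.1)].
pose B := [set p : {set T} * T | (p.1 \in shadow H) && (p.2 \in V :\: p.1)].
have cA : #|A| = #|H| * k.
  rewrite (card_dep_pairs id) -sum_nat_const; apply: eq_bigr => S; exact: uH.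
have cB : #|B| = #|shadow H| * (#|V| - k.-1).
  rewrite (card_dep_pairs (fun S => V :\: S)) -sum_nat_const.
  apply: eq_bigr => P /in_shadow[y yP yPH].
  have PV : P \subset V := subset_trans (subsetUr _ _) (HV _ yPH).
  by rewrite cardsDS // -(uH _ yPH) cardsU1 yP.
have fI : {in A &, injective f}.
  move=> [S y] [S' y']; rewrite !inE /= => /andP[_ yS] /andP[_ yS'] [e ey].
  by subst y'; rewrite -(setD1K yS) e setD1K.
have fAB : f @: A \subset B.
  apply/subsetP=> _ /imsetP[[S y] + ->]; rewrite !inE /= => /andP[SH yS].
  rewrite eqxx (subsetP (HV _ SH)) //= andbT.
  by apply/imset2P; exists S y.
have := subset_leq_card fAB; rewrite card_in_imset // cA cB.
move: dH; rewrite /deficient => dH.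
case: k uH kV cA cB => // k _ kV _ _ /= le.
rewrite leqNgt; apply/negP => lt.
have : #|shadow H| * (#|V| - k) <= #|shadow H| * k.+1.
  by rewrite leq_mul2l; apply/orP; right; lia.
move=> le2; have := leq_trans le le2.
by rewrite leq_pmul2r // leqNgt dH.
Qed.

End Deficient.

(** * Shifting (compression) and what it preserves *)

Section Shift.
Variables (T : finType) (x z : T).
Implicit Types (P S U V : {set T}) (F G H : {set {set T}}).

Definition swap S : {set T} := tperm x z @^-1: S.

(* Replaces x by z in each member of H where the result is not yet in H. *)
Definition shift H : {set {set T}} :=
  [set S : {set T} | if (x \in S) && (z \notin S) then (S \in H) && (swap S \in H)
           else if (z \in S) && (x \notin S) then (S \in H) || (swap S \in H)
           else S \in H].

Lemma swapK : involutive swap.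
Proof. by move=> S; apply/setP=> y; rewrite !inE tpermK. Qed.

Lemma swap_id S : (x \in S) = (z \in S) -> swap S = S.
Proof. by move=> e; apply/setP=> y; rewrite inE; case: tpermP => [->|->|]. Qed.

Lemma card_swap S : #|swap S| = #|S|.
Proof. by rewrite card_preimset //; apply: perm_inj. Qed.

Lemma swapU1 y S : swap (y |: S) = tperm x z y |: swap S.
Proof.
apply/setP=> u; rewrite !inE; congr (_ || _).
by rewrite -(inj_eq (@perm_inj _ (tperm x z))) tpermK.
Qed.

Lemma swapI S U : swap (S :&: U) = swap S :&: swap U.
Proof. exact: preimsetI. Qed.

Lemma x_swap S : (x \in swap S) = (z \in S).
Proof. by rewrite inE tpermL. Qed.

Lemma z_swap S : (z \in swap S) = (x \in S).
Proof. by rewrite inE tpermR. Qed.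

Lemma in_shift H S : (S \in shift H) =
  if (x \in S) && (z \notin S) then (S \in H) && (swap S \in H)
  else if (z \in S) && (x \notin S) then (S \in H) || (swap S \in H)
  else S \in H.
Proof. by rewrite in_set. Qed.

Lemma shift_or_swap H S : S \in shift H -> (S \in H) || (swap S \in H).
Proof.
rewrite in_shift; case: ifP => _; first by case/andP=> ->.
by case: ifP => // _ ->.
Qed.

Lemma shift_xP H S : x \in S -> S \in shift H -> S \in H.
Proof. by move=> xS; rewrite in_shift xS andbF /=; case: ifP => // _ /andP[]. Qed.

(** The shift keeps the number of members in each pair {S, [swap S]}, and summing over all S counts
    every member of a family twice. *)
Lemma card_shift H : #|shift H| = #|H|.
Proof.
have dbl (K : {set {set T}}) :
    #|K|.*2 = \sum_S ((S \in K) + (swap S \in K)).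
  rewrite big_split /= -addnn; congr (_ + _).
    by rewrite -sum1_card big_mkcond; apply: eq_bigr => S _; case: ifP.
  rewrite (reindex_inj (inv_inj swapK)) /= -sum1_card big_mkcond.
  by apply: eq_bigr => S _; rewrite swapK; case: ifP.
apply: double_inj; rewrite !dbl; apply: eq_bigr => S _.
rewrite !in_shift !x_swap !z_swap swapK.
by case: (boolP (x \in S)) => xS; case: (boolP (z \in S)) => zS //=;
  case: (S \in H); case: (swap S \in H).
Qed.

Lemma shift_uniform k H : uniform k H -> uniform k (shift H).
Proof.
by move=> uH S /shift_or_swap/orP[/uH//|/uH]; rewrite card_swap.
Qed.

Lemma shift_sub V H : x \in V -> z \in V ->
  (forall S, S \in H -> S \subset V) -> forall S, S \in shift H -> S \subset V.
Proof.
move=> xV zV HV S /shift_or_swap/orP[/HV//|/HV sV].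
rewrite -[S]swapK -(@swap_id V) ?xV ?zV //; exact: preimsetS.
Qed.

Lemma shadow_shift H : shadow (shift H) \subset shift (shadow H).
Proof.
have sw P y : y \notin P -> y |: P \in H -> P \in shadow H.
  by move=> yP yPH; apply/in_shadow; exists y.
apply/subsetP=> P /in_shadow[y yP yPH].
have Por : (P \in shadow H) || (swap P \in shadow H).
  case/orP: (shift_or_swap yPH) => [/sw->//|].
  rewrite swapU1 => /sw -> //; rewrite ?orbT //.
  by rewrite inE tpermK.
(* [Por] suffices unless P contains x but not z; then both P and [swap P] have to lie in
   [shadow H]. *)
rewrite in_shift; case: ifP => [/andP[xP zP]|nxz]; last first.
  case: ifP => // nzx; move: Por; rewrite swap_id ?orbb //.
  by move: nxz nzx; case: (x \in P); case: (z \in P).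
(* For y = z, the set z |: P is in H and fixed by [swap]; deleting z gives P, deleting x gives
   [swap P]. *)
have [yz|nyz] := eqVneq y z.
  subst y; move: yPH => /shift_xP; rewrite !inE xP orbT => /(_ isT) PH.
  rewrite (sw _ _ zP PH) /=; apply: (sw _ x); first by rewrite x_swap.
  rewrite -[x](@tpermR _ x z) -swapU1 swap_id //.
  by rewrite !inE eqxx xP orbT.
move: yPH; rewrite in_shift !in_setU1 xP orbT eq_sym (negPf nyz) /= zP => /andP[PH sPH].
rewrite (sw _ _ yP PH); rewrite swapU1 in sPH; apply: sw sPH.
by rewrite inE tpermK.
Qed.

Lemma shift_deficient H : deficient H -> deficient (shift H).
Proof.
rewrite /deficient card_shift; apply: leq_ltn_trans.
by rewrite -[#|shadow H|]card_shift subset_leq_card // shadow_shift.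
Qed.

(** The new set S contains z, so U does not; then [swap U] is in G whether or not U contains x.
    Hence a disjoint pair with a new member swaps back to a disjoint pair in F and G. *)
Lemma shift_new_disjoint F G S U : S \in shift F -> S \notin F ->
  U \in shift G -> S :&: U = set0 -> swap S \in F /\ swap U \in G.
Proof.
move=> SF nSF UG dSU.
have zS : z \in S.
  move: SF; rewrite in_shift (negPf nSF) /=; case: ifP => // _.
  by case: ifP => // /andP[].
have zU : z \notin U.
  by apply/negP=> zU; have := in_set0 z; rewrite -dSU inE zS zU.
split; first by have := shift_or_swap SF; rewrite (negPf nSF).
move: UG; rewrite in_shift zU andbT; case: ifP => [_ /andP[]//|xU /=].
by rewrite swap_id // xU (negPf zU).
Qed.

Lemma shift_cross F G :
  cross_intersecting F G -> cross_intersecting (shift F) (shift G).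
Proof.
move=> FG S U SF UG; apply/negP=> /eqP dSU.
have swd : swap S :&: swap U = set0 by rewrite -swapI dSU /swap preimset0.
have [SF'|nSF] := boolP (S \in F); last first.
  have [sS sU] := shift_new_disjoint SF nSF UG dSU.
  by have := FG _ _ sS sU; rewrite swd eqxx.
have [UG'|nUG] := boolP (U \in G).
  by have := FG _ _ SF' UG'; rewrite dSU eqxx.
have [|sU sS] := @shift_new_disjoint G F U S UG nUG SF; first by rewrite setIC.
by have := FG _ _ sS sU; rewrite swd eqxx.
Qed.

Lemma shift_degree H :
  [set S in shift H | x \in S] \subset [set S in H | x \in S].
Proof.
by apply/subsetP=> S; rewrite !inE => /andP[SH xS]; rewrite xS (shift_xP xS) ?inE.
Qed.

Lemma shift_degree_lt H S :
  S \in H -> x \in S -> z \notin S -> swap S \notin H ->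
  #|[set S in shift H | x \in S]| < #|[set S in H | x \in S]|.
Proof.
move=> SH xS zS sS; apply: proper_card; apply/properP; split.
  exact: shift_degree.
by exists S; rewrite !inE ?SH ?xS ?zS //= (negPf sS).
Qed.

End Shift.

(** * Cross-intersecting families are not both deficient *)

Section CrossIntersecting.
Variable T : finType.
Implicit Types (x y z : T) (A B M N S U V X Y : {set T}) (F G H : {set {set T}}).

Definition shifted_from x V H := forall S z,
  S \in H -> x \in S -> z \in V -> z \notin S -> swap x z S \in H.

(** Each shift applied lowers the number of members of F containing x, so the process ends. G
    undergoes the same shifts to stay cross-intersecting with F. *)
Lemma exists_shifted_pair x V k l F G : x \in V ->
  (forall S, S \in F -> S \subset V) -> (forall S, S \in G -> S \subset V) ->
  uniform k F -> uniform l G -> cross_intersecting F G ->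
  deficient F -> deficient G ->
  exists F' G' : {set {set T}},
    [/\ (forall S, S \in F' -> S \subset V) /\ (forall S, S \in G' -> S \subset V),
        uniform k F' /\ uniform l G', cross_intersecting F' G',
        deficient F' /\ deficient G' & shifted_from x V F'].
Proof.
move=> xV; move: {2}_.+1 (ltnSn #|[set S in F | x \in S]|) => m.
elim: m F G => // m IH F G ltm FV GV uF uG FG dF dG.
case: (boolP [exists S in F, exists z in V,
  [&& x \in S, z \notin S & swap x z S \notin F]]).
  case/existsP=> S /andP[SF /existsP[z /andP[zV /and3P[xS zS sS]]]].
  apply: (IH (shift x z F) (shift x z G)).
  - by apply: leq_trans (shift_degree_lt SF xS zS sS) _; rewrite -ltnS.
  - exact: shift_sub.
  - exact: shift_sub.
  - exact: shift_uniform.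
  - exact: shift_uniform.
  - exact: shift_cross.
  - exact: shift_deficient.
  - exact: shift_deficient.
move=> nex; exists F, G; split=> // S z SF xS zV zS; apply/negPn/negP=> sS.
case/negP: nex; apply/existsP; exists S; rewrite SF; apply/existsP; exists z.
by rewrite zV xS zS.
Qed.

Lemma link1_uniform k H x : uniform k H -> uniform k.-1 (link H [set x]).
Proof.
by move=> uH S; rewrite in_link1 => /andP[xS /uH]; rewrite cardsU1 xS => <-.
Qed.

Lemma avoiding_uniform k H X : uniform k H -> uniform k (avoiding H X).
Proof. by move=> uH S; rewrite in_avoiding => /andP[/uH]. Qed.

Lemma link1_subD1 V H x : (forall S, S \in H -> S \subset V) ->
  forall S, S \in link H [set x] -> S \subset V :\ x.
Proof.
move=> HV S; rewrite in_link1 subsetD1 => /andP[-> /HV]; rewrite andbT.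
exact: subset_trans (subsetUr _ _).
Qed.

Lemma avoiding1_subD1 V H x : (forall S, S \in H -> S \subset V) ->
  forall S, S \in avoiding H [set x] -> S \subset V :\ x.
Proof.
by move=> HV S; rewrite in_avoiding1 subsetD1 => /andP[/HV -> ->].
Qed.

Lemma cross_intersectingC F G :
  cross_intersecting F G -> cross_intersecting G F.
Proof. by move=> FG S U SG UF; rewrite setIC; apply: FG. Qed.

Lemma cross_link1_avoiding F G x : cross_intersecting F G ->
  cross_intersecting (link F [set x]) (avoiding G [set x]).
Proof.
move=> FG S U; rewrite in_link1 in_avoiding1 => /andP[xS SF] /andP[UG xU].
by have := FG _ _ SF UG; rewrite setIUl setU_eq0 (setI_eq0 [set x]) disjoints1 xU.
Qed.

Lemma cross_deficient V k l F G :
  (forall S, S \in F -> S \subset V) -> (forall S, S \in G -> S \subset V) ->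
  uniform k F -> uniform l G -> cross_intersecting F G ->
  deficient F -> deficient G -> False.
Proof.
move Em: #|V| => m; elim: m V Em k l F G => [|m IH] V Em k l F G FV GV uF uG FG dF dG.
  have [S SF] := deficient_nonempty dF; have [U UG] := deficient_nonempty dG.
  have := FG _ _ SF UG; have := FV _ SF.
  by rewrite (cards0_eq Em) subset0 => /eqP->; rewrite set0I eqxx.
have [x xV] : exists x, x \in V by apply/card_gt0P; rewrite Em.
have [F' [G' [[F'V G'V] [uF' uG'] FG' [dF' dG'] sF]]] :=
  exists_shifted_pair xV FV GV uF uG FG dF dG.
have EV : #|V :\ x| = m by have := cardsD1 x V; rewrite xV Em => -[].
have [dFa|dFl] := deficient_split x dF'; have [dGa|dGl] := deficient_split x dG'.
- apply: IH EV _ _ _ _ _ _ _ _ _ dFa dGa.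
  + exact: avoiding1_subD1.
  + exact: avoiding1_subD1.
  + exact: avoiding_uniform uF'.
  + exact: avoiding_uniform uG'.
  + by move=> S U; rewrite !in_avoiding => /andP[SF _] /andP[UG _]; apply: FG'.
- apply: IH EV _ _ _ _ _ _ _ _ _ dFa dGl.
  + exact: avoiding1_subD1.
  + exact: link1_subD1.
  + exact: avoiding_uniform uF'.
  + exact: link1_uniform uG'.
  + by apply: cross_intersectingC; apply: cross_link1_avoiding;
      apply: cross_intersectingC.
- apply: IH EV _ _ _ _ _ _ _ _ _ dFl dGa.
  + exact: link1_subD1.
  + exact: avoiding1_subD1.
  + exact: link1_uniform uF'.
  + exact: avoiding_uniform uG'.
  + exact: cross_link1_avoiding.
apply: (IH _ EV _ _ _ _ _ _ _ _ _ dFl dGl).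
- exact: link1_subD1.
- exact: link1_subD1.
- exact: link1_uniform uF'.
- exact: link1_uniform uG'.
move=> S U SF UG; apply/negP=> /eqP dSU.
have cS := link1_uniform uF' SF; have cU := link1_uniform uG' UG.
move: (SF) (UG); rewrite !in_link1 => /andP[xS xSF] /andP[xU xUG].
(* Positivity makes the predecessors in [cS] and [cU] genuine: |S ∪ U| <= k + l - 2 <= |V| - 2,
   which leaves a point of V \ x outside S and U. *)
have k_gt0 : 0 < k by rewrite -(uF' _ xSF) cardsU1 xS.
have l_gt0 : 0 < l by rewrite -(uG' _ xUG) cardsU1 xU.
have kV := deficient_card F'V uF' dF'; have lV := deficient_card G'V uG' dG'.
have [z] : exists z, z \in (V :\ x) :\: (S :|: U).
  apply/card_gt0P; have := cardsD (V :\ x) (S :|: U); rewrite EV.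
  have := subset_leq_card (subsetIr (V :\ x) (S :|: U)).
  have [+ _] := leq_card_setU S U; rewrite cS cU.
  move: kV lV; rewrite Em; move=> *; lia.
rewrite !inE negb_or => /and3P[/andP[zS zU] zx zV].
have zxS : z \notin x |: S by rewrite !inE negb_or zx.
(* Exchanging x for z in x |: S puts z |: S in F', and this set misses x |: U. *)
have := sF _ _ xSF (setU11 _ _) zV zxS.
rewrite swapU1 tpermL swap_id ?(negPf xS) ?(negPf zS) // => zSF.
have /negP := FG' _ _ zSF xUG; apply; apply/eqP/setP=> y.
move/setP: dSU => /(_ y); rewrite !inE.
case: (y =P z) => [->|_] /=; first by rewrite (negPf zx) (negPf zU).
by case: (y =P x) => [->|] //=; rewrite (negPf xS).
Qed.

(** * Pseudo-intersecting links and one step of the construction of the M_i *)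

Definition pseudob H := [forall X, #|avoiding H X| <= #|shadow (avoiding H X)|].

Lemma pseudobP H : reflect (pseudo_intersecting H) (pseudob H).
Proof. exact: forallP. Qed.

Lemma pseudo_set0 : pseudo_intersecting (set0 : {set {set T}}).
Proof.
move=> X; suff -> : avoiding set0 X = set0 :> {set {set T}} by rewrite cards0.
by apply/setP=> S; rewrite in_avoiding !inE.
Qed.

(** X is taken maximal. For y in M outside X, splitting at y would contradict either this maximality
    or the hypothesis on the link at y. *)
Lemma deficient_avoiding_sup H M :
  (forall y, y \in M -> pseudo_intersecting (link H [set y])) ->
  ~~ pseudob H -> exists2 X : {set T}, M \subset X & deficient (avoiding H X).
Proof.
move=> Ml; rewrite negb_forall => /existsP[X0]; rewrite -ltnNge => dX0.
have [X /maxsetP[dX maxX] _] :=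
  @maxset_exists _ (fun X => deficient (avoiding H X)) _ dX0.
exists X => //; apply/subsetP=> y yM; apply/negPn/negP=> yX.
case: (deficient_split y dX).
  rewrite avoiding_avoiding1 => /maxX /(_ (subsetUr _ _)) e.
  by rewrite -e setU11 in yX.
by rewrite link1_avoiding // /deficient ltnNge Ml.
Qed.

Lemma link_uniform k H A : uniform k H -> uniform (k - #|A|) (link H A).
Proof.
move=> uH S; rewrite in_link => /andP[/eqP dSA /uH <-].
by rewrite cardsU setIC dSA cards0 subn0 addKn.
Qed.

(** A common point e of A ∪ S and B ∪ U lies in S and in U: if e were in A, it would be outside B,
    hence in U and in M \ B, which U avoids. The case of e in B is symmetric. *)
Lemma cross_avoiding_link F G M A B X Y : cross_intersecting F G ->
  A \subset M -> B \subset M -> [disjoint A & B] ->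
  M :\: A \subset X -> M :\: B \subset Y ->
  cross_intersecting (avoiding (link F A) X) (avoiding (link G B) Y).
Proof.
move=> FG /subsetP AM /subsetP BM dAB /subsetP MX /subsetP MY S U.
rewrite !in_avoiding !in_link.
case/andP=> /andP[/eqP/setP dSA SF] /eqP/setP dSX.
case/andP=> /andP[/eqP/setP dUB UG] /eqP/setP dUY.
have /set0Pn[e] := FG _ _ SF UG; rewrite !inE => /andP[eAS eBU].
apply/set0Pn; exists e; rewrite inE.
have := dSA e; have := dSX e; have := dUB e; have := dUY e; rewrite !inE.
have := MX e; have := MY e; have := AM e; have := BM e; rewrite !inE.
have : ~~ ((e \in A) && (e \in B)).
  by apply/negP=> /andP[eA eB]; have := disjointFr dAB eA; rewrite eB.
move: eAS eBU; case: (e \in A); case: (e \in B); case: (e \in S);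
  case: (e \in U); case: (e \in M); case: (e \in X); case: (e \in Y) => //=;
  by intuition.
Qed.

(** The step from N = M_(i+1) to N' = M_i. The dichotomy is a premise inside the conclusion and N'
    comes before i, so that N' exists for every N and can be chosen as a function of N alone. *)
Lemma next_core k l F G N :
  uniform k F -> uniform l G -> cross_intersecting F G ->
  exists N' : {set T}, [/\ N' \subset N, #|N| <= #|N'| + l &
    ~ (forall B, B \subset N -> pseudo_intersecting (link G B)) ->
    forall i,
    (forall A, A \subset N -> #|A| = i.+1 -> pseudo_intersecting (link F A)) ->
    forall A, A \subset N' -> #|A| = i -> pseudo_intersecting (link F A)].
Proof.
move=> uF uG FG.
case: (boolP [exists B : {set T}, (B \subset N) && ~~ pseudob (link G B)]); last first.
  move=> nex; exists N; split=> //; first exact: leq_addr.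
  case=> B BN; apply/pseudobP/negPn/negP=> nB.
  by case/negP: nex; apply/existsP; exists B; rewrite BN.
case/existsP=> B0 B0P.
have [B /maxsetP[/andP[BN nB] maxB] _] :=
  @maxset_exists _ (fun B => (B \subset N) && ~~ pseudob (link G B)) _ B0P.
have linkB y : y \in N :\: B -> pseudo_intersecting (link (link G B) [set y]).
  rewrite inE => /andP[yB yN]; rewrite link_link1 //; apply/pseudobP/negPn/negP.
  move=> nyB; have := maxB (y |: B); rewrite subUset sub1set yN BN nyB subsetUr.
  by move=> /(_ isT isT) e; rewrite -e setU11 in yB.
have [Y NY dY] := deficient_avoiding_sup linkB nB.
exists (N :\: B); split=> [||_ i Pi A AN cA]; first exact: subsetDl.
  (* A member U of G(B) gives a set B ∪ U of size l, so |B| <= l. *)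
  have [U] := deficient_nonempty dY.
  rewrite in_avoiding in_link => /andP[/andP[_ /uG <-] _].
  rewrite -(cardsID B N) addnC leq_add2l.
  exact: leq_trans (subset_leq_card (subsetIr _ _)) (subset_leq_card (subsetUl _ _)).
have /subsetDP[AN' dAB] := AN.
apply/pseudobP/negPn/negP=> nA.
have linkA y : y \in N :\: A -> pseudo_intersecting (link (link F A) [set y]).
  rewrite inE => /andP[yA yN]; rewrite link_link1 //; apply: Pi.
    by rewrite subUset sub1set yN.
  by rewrite cardsU1 yA cA.
have [X NX dX] := deficient_avoiding_sup linkA nA.
apply: (@cross_deficient setT _ _ _ _ _ _ _ _ _ dX dY).
- by move=> S _; apply: subsetT.
- by move=> S _; apply: subsetT.
- exact: avoiding_uniform (link_uniform uF).
- exact: avoiding_uniform (link_uniform uG).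
- exact: cross_avoiding_link NX NY.
Qed.

End CrossIntersecting.

(* [n] is 'I_n.  Only M 1, ..., M k and, for k = 1, the set M 2 of (2) matter;
   the latter is fixed by the convention M (k+1) = [n], in line with the bound
   |M i| >= n - (k+1-i)l at i = k+1.  For k >= 2 that clause is vacuous. *)
Theorem theorem1p7 (n k l : nat) (n_gt0 : 0 < n) (k_gt0 : 0 < k) (l_gt0 : 0 < l)
    (F G : {set {set 'I_n}}) (F_unif : uniform k F) (G_unif : uniform l G)
    (FG_cross : cross_intersecting F G) :
  exists M : nat -> {set 'I_n},
    [/\ forall i, 1 <= i < k -> M i \subset M i.+1,
        forall i, 1 <= i <= k -> n <= #|M i| + (k + 1 - i) * l,
        M k.+1 = [set: 'I_n] &
        (forall (i : nat) (A : {set 'I_n}), 1 <= i <= k ->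
           A \subset M i -> #|A| = i -> pseudo_intersecting (link F A))
        \/
        (forall B : {set 'I_n}, B \subset M 2 -> pseudo_intersecting (link G B))].
Proof.
have [next nextP] :=
  fin_all_exists (fun N => next_core N F_unif G_unif FG_cross).
(* [R d] plays the role of M_(k+1-d): d counts the steps down from [n]. *)
pose R d := iter d next [set: 'I_n].
have sizeR d : n <= #|R d| + d * l.
  elim: d => [|d IH]; first by rewrite cardsT card_ord addn0.
  have [_ le _] := nextP (R d); rewrite mulSn addnA.
  by apply: leq_trans IH _; rewrite leq_add2r.
have subR d : R d.+1 \subset R d by have [] := nextP (R d).
have monoR d e : d <= e -> R e \subset R d.
  move=> /subnK <-; elim: (e - d) => // m IH.
  exact: subset_trans (subR _) IH.
exists (fun i => R (k + 1 - i)); split.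
- by move=> i /andP[_ ik]; apply: monoR; lia.
- by move=> i _; apply: sizeR.
- by rewrite addn1 subnn.
have [allB|nallB] := boolP
  [forall (B : {set 'I_n} | B \subset R (k + 1 - 2)), pseudob (link G B)].
  by right=> B BM; apply/pseudobP; move/forall_inP: allB; apply.
left=> i A /andP[i_gt0 ik] AM cA.
(* The size of A descends from k + 1, where the link of the k-uniform F is empty. *)
have PR d : d <= k -> forall A : {set 'I_n}, A \subset R d -> #|A| = k.+1 - d ->
    pseudo_intersecting (link F A).
  elim: d => [|d IH] dk A' AR cA'.
    suff -> : link F A' = set0 by apply: pseudo_set0.
    apply/setP=> S; rewrite in_link inE; apply/negP=> /andP[_ /F_unif cAS].
    by have := subset_leq_card (subsetUl A' S); rewrite cAS cA' subn0 ltnn.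
  have [_ _ step] := nextP (R d).
  apply: (step _ (k - d)) => // [allB|A2 A2R cA2].
    (* Since d < k, the set [R (k + 1 - 2)] lies in [R d], so [allB] would yield alternative (2),
       which [nallB] excludes. *)
    case/negP: nallB; apply/forall_inP=> B BM; apply/pseudobP/allB.
    by apply: subset_trans BM _; apply: monoR; lia.
  by apply: IH => //; [lia | rewrite cA2; lia].
by apply: PR AM _; [lia | rewrite cA; lia].
Qed.
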